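(* Let $\mathcal{I}$ be a collection of intervals in a poset $P$. Let $\mathcal{R},\mathcal{S},\mathcal{R}^*,\mathcal{S}^*$ be multi-sets of elements of $\widehat{\mathcal{I}}$ whose corresponding representations $\mathbf{k}_{\mathcal{R}},\mathbf{k}_{\mathcal{S}},\mathbf{k}_{\mathcal{R}^*},\mathbf{k}_{\mathcal{S}^*}$ lie in $\operatorname{rep}_{\mathcal{I}}P$, and such that $\mathcal{R}^*\cap\mathcal{S}^*=\emptyset$. If \[ \operatorname{Rk}_{\mathcal{I}}\mathbf{k}_{\mathcal{R}}-\operatorname{Rk}_{\mathcal{I}}\mathbf{k}_{\mathcal{S}}=\operatorname{Rk}_{\mathcal{I}}\mathbf{k}_{\mathcal{R}^*}-\operatorname{Rk}_{\mathcal{I}}\mathbf{k}_{\mathcal{S}^*}, \] then $\mathcal{R}\supseteq\mathcal{R}^*$, $\mathcal{S}\supseteq\mathcal{S}^*$, and $\mathcal{R}\setminus\mathcal{R}^*=\mathcal{S}\setminus\mathcal{S}^*$ (as multi-sets).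
   Context: Fix a field $\mathbf{k}$. An interval in a poset $P$ is a non-empty subset $I$ that is convex ($s\le u\le t$ with $s,t\in I$ implies $u\in I$) and connected (any two elements of $I$ are joined by a finite sequence of elements of $I$ with consecutive ones comparable). $\mathbf{k}_I\colon P\to\mathrm{Vec}_{\mathbf{k}}$ is the representation equal to $\mathbf{k}$ on $I$ and $0$ elsewhere, with identity maps between comparable elements of $I$; for a multi-set $\mathcal{R}$ of intervals, $\mathbf{k}_{\mathcal{R}}=\bigoplus_{R\in\mathcal{R}}\mathbf{k}_R$ (with multiplicity). For $M\colon P\to\mathrm{Vec}_{\mathbf{k}}$ and an interval $I$, $\operatorname{Rk}_I M=\operatorname{rank}\left[\varprojlim M|_I\to\varinjlim M|_I\right]\in\mathbb{N}\cup\{\infty\}$ (the canonical map); $\operatorname{Rk}_{\mathcal{I}}M$ is the function $I\mapsto\operatorname{Rk}_IM$ on $\mathcal{I}$; and $\operatorname{rep}_{\mathcal{I}}P$ is the class of representations $M$ for which $\operatorname{Rk}_{\mathcal{I}}M$ takes only finite values. $\widehat{\mathcal{I}}=\left\{\bigcup X\mid X\subseteq\mathcal{I}\text{ directed}\right\}$, where (a non-empty) $X$ is directed if for all $I_1,I_2\in X$ there is $I_3\in X$ with $I_1\cup I_2\subseteq I_3$. Elements of $\widehat{\mathcal{I}}$ are again intervals. *)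

(* Defs.v *)
From HB Require Import structures.
From mathcomp Require Import all_boot all_order all_algebra.
From mathcomp Require Import ring_quotient generic_quotient.
From mathcomp Require Import boolp classical_sets cardinality.

Set Implicit Arguments.
Unset Strict Implicit.
Unset Printing Implicit Defensive.

Import Order.TTheory GRing.Theory.

Local Open Scope classical_set_scope.
Local Open Scope ring_scope.

Definition dprod (k : fieldType) (T : eqType) (V : T -> lmodType k) :=
  forall i, V i.
Identity Coercion dprod_fun : dprod >-> Funclass.

Section DirectProduct.
Variables (k : fieldType) (T : eqType) (V : T -> lmodType k).
Notation dprod := (dprod V).

HB.instance Definition _ := Choice.copy dprod (forall i, V i).

Fact dprod_addA : associative (fun x y : dprod => (fun i => x i + y i) : dprod).
Proof. by move=> x y z; apply: functional_extensionality_dep => i; rewrite addrA. Qed.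
Fact dprod_addC : commutative (fun x y : dprod => (fun i => x i + y i) : dprod).
Proof. by move=> x y; apply: functional_extensionality_dep => i; rewrite addrC. Qed.
Fact dprod_add0 :
  left_id ((fun=> 0) : dprod) (fun x y : dprod => (fun i => x i + y i) : dprod).
Proof. by move=> x; apply: functional_extensionality_dep => i; rewrite add0r. Qed.
Fact dprod_addN :
  left_inverse ((fun=> 0) : dprod) (fun x : dprod => (fun i => - x i) : dprod)
    (fun x y : dprod => (fun i => x i + y i) : dprod).
Proof. by move=> x; apply: functional_extensionality_dep => i; rewrite addNr. Qed.

HB.instance Definition _ :=
  GRing.isZmodule.Build dprod dprod_addA dprod_addC dprod_add0 dprod_addN.

Let scale (a : k) (x : dprod) : dprod := fun i => a *: x i.

Fact dprod_scaleA a b x : scale a (scale b x) = scale (a * b) x.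
Proof. by apply: functional_extensionality_dep => i; rewrite /scale scalerA. Qed.
Fact dprod_scale1 : left_id 1 scale.
Proof. by move=> x; apply: functional_extensionality_dep => i; rewrite /scale scale1r. Qed.
Fact dprod_scaleDr : right_distributive scale +%R.
Proof. by move=> a x y; apply: functional_extensionality_dep => i; rewrite /scale scalerDr. Qed.
Fact dprod_scaleDl x : {morph scale^~ x : a b / a + b}.
Proof. by move=> a b; apply: functional_extensionality_dep => i; rewrite /scale scalerDl. Qed.

HB.instance Definition _ := GRing.Zmodule_isLmodule.Build k dprod
  dprod_scaleA dprod_scale1 dprod_scaleDr dprod_scaleDl.

Lemma dprodDE (x y : dprod) i : (x + y) i = x i + y i. Proof. by []. Qed.
Lemma dprodZE a (x : dprod) i : (a *: x) i = a *: x i. Proof. by []. Qed.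
Lemma dprod0E i : (0 : dprod) i = 0. Proof. by []. Qed.

Definition fin_supp : {pred dprod} :=
  fun x => `[< finite_set [set i | x i != 0] >].

Fact fin_supp_closed : submod_closed fin_supp.
Proof.
split=> [|a x y /asboolP fx /asboolP fy]; apply/asboolP.
  apply: (@sub_finite_set _ _ set0); last exact: finite_set0.
  by move=> i /=; rewrite eqxx.
apply: (@sub_finite_set _ _ ([set i | x i != 0] `|` [set i | y i != 0])).
  move=> i /=; rewrite dprodDE dprodZE => nz.
  case: (eqVneq (x i) 0) nz => [->|]; last by left.
  by rewrite scaler0 add0r; right.
by rewrite finite_setU.
Qed.

HB.instance Definition _ :=
  GRing.isSubmodClosed.Build k dprod fin_supp fin_supp_closed.

Record dsum := DSum { dsum_fun :> dprod; _ : dsum_fun \in fin_supp }.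

HB.instance Definition _ := [isSub for dsum_fun].
HB.instance Definition _ := [Choice of dsum by <:].
HB.instance Definition _ := [SubChoice_isSubLmodule of dsum by <:].

Lemma dsum_funP (x y : dsum) : (forall i, x i = y i) -> x = y.
Proof. by move=> xy; apply: val_inj; exact: functional_extensionality_dep. Qed.

Fact dsum_in_subproof i (x : V i) :
  (dfwith (fun j => 0 : V j) x : dprod) \in fin_supp.
Proof.
apply/asboolP; apply: (@sub_finite_set _ _ [set i]); last exact: finite_set1.
by move=> j /=; case: dfwithP => // j' _; rewrite eqxx.
Qed.

Definition dsum_in i (x : V i) : dsum := DSum (dsum_in_subproof x).

Lemma dsum_inE i (x : V i) : dsum_in x i = x.
Proof. exact: dfwith_in. Qed.

Lemma dsum_in_out i (x : V i) j : i != j -> dsum_in x j = 0.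
Proof. exact: dfwith_out. Qed.

Fact dsum_in_linear i : linear (@dsum_in i).
Proof.
move=> a x y; apply: dsum_funP => j.
change (dsum_in (a *: x + y) j = a *: dsum_in x j + dsum_in y j).
have [<-|ij] := eqVneq i j; first by rewrite !dsum_inE.
by rewrite !dsum_in_out// scaler0 addr0.
Qed.

HB.instance Definition _ i :=
  GRing.isLinear.Build k (V i) dsum _ (@dsum_in i) (@dsum_in_linear i).

End DirectProduct.

Section DirectSumMap.
Variables (k : fieldType) (T : eqType) (V W : T -> lmodType k).
Variable f : forall i, {linear V i -> W i}.

Fact dsum_map_subproof (x : dsum V) :
  ((fun i => f i (x i)) : dprod W) \in @fin_supp k T W.
Proof.
case: x => x /= /asboolP fx; apply/asboolP; apply: sub_finite_set fx => i /=.
by apply: contra_neq => ->; rewrite linear0.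
Qed.

Definition dsum_map (x : dsum V) : dsum W := DSum (dsum_map_subproof x).

Fact dsum_map_linear : linear dsum_map.
Proof. by move=> a x y; apply: dsum_funP => i; exact: linearP. Qed.

HB.instance Definition _ :=
  GRing.isLinear.Build k (dsum V) (dsum W) _ dsum_map dsum_map_linear.

End DirectSumMap.

Section Span.
Variables (k : fieldType) (V : lmodType k) (A : set V).

Definition span : {pred V} :=
  fun x => `[< forall W : submodClosed V, (forall y, A y -> y \in W) -> x \in W >].

Fact span_closed : submod_closed span.
Proof.
split=> [|a x y /asboolP sx /asboolP sy]; apply/asboolP => W AW.
  exact: rpred0.
by rewrite rpredD ?rpredZ ?sx ?sy.
Qed.

HB.instance Definition _ := GRing.isSubmodClosed.Build k V span span_closed.

Lemma sub_span x : A x -> x \in span.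
Proof. by move=> Ax; apply/asboolP => W; apply. Qed.

End Span.

Section QuotientSpace.
Variables (k : fieldType) (V : lmodType k) (A : set V).
Local Open Scope quotient_scope.

Definition quot_space := Quotient.quot (span A).

HB.instance Definition _ := GRing.Zmodule.on quot_space.

Definition quot_proj (x : V) : quot_space := \pi_quot_space x.

Lemma quot_projE x y : (quot_proj x == quot_proj y) = (x - y \in span A).
Proof. by rewrite Quotient.idealrBE. Qed.

Fact quot_projD : {morph quot_proj : x y / x + y}.
Proof. by move=> x y; exact: (@Quotient.pi_add _ (span A)). Qed.

Lemma quot_projK (u : quot_space) : quot_proj (repr u) = u.
Proof. exact: reprK. Qed.

Let scale (a : k) (u : quot_space) := quot_proj (a *: repr u).

Fact quot_proj_scale a x : scale a (quot_proj x) = quot_proj (a *: x).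
Proof.
apply/eqP; rewrite quot_projE -scalerBr rpredZ// -quot_projE.
by rewrite quot_projK.
Qed.

Fact quot_scaleA a b u : scale a (scale b u) = scale (a * b) u.
Proof. by rewrite -[u]quot_projK !quot_proj_scale scalerA. Qed.
Fact quot_scale1 : left_id 1 scale.
Proof. by move=> u; rewrite -[u]quot_projK !quot_proj_scale scale1r. Qed.
Fact quot_scaleDr : right_distributive scale +%R.
Proof.
move=> a u v; rewrite -[u]quot_projK -[v]quot_projK -quot_projD.
by rewrite !quot_proj_scale -quot_projD scalerDr.
Qed.
Fact quot_scaleDl u : {morph scale^~ u : a b / a + b}.
Proof.
by move=> a b; rewrite -[u]quot_projK !quot_proj_scale -quot_projD scalerDl.
Qed.

HB.instance Definition _ := GRing.Zmodule_isLmodule.Build k quot_space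
  quot_scaleA quot_scale1 quot_scaleDr quot_scaleDl.

Fact quot_proj_linear : linear quot_proj.
Proof. by move=> a x y; rewrite quot_projD -quot_proj_scale. Qed.

HB.instance Definition _ :=
  GRing.isLinear.Build k V quot_space _ quot_proj quot_proj_linear.

End QuotientSpace.

Section Rank.
Variables (k : fieldType).

Definition is_basis (V : lmodType k) (W : set V) n (b : 'I_n -> V) :=
  (forall c : 'I_n -> k, \sum_i c i *: b i = 0 -> forall i, c i = 0) /\
  W = [set \sum_i c i *: b i | c in [set: 'I_n -> k]].

(* Valued in N + {oo}, where [None] stands for oo. *)
Definition dim (V : lmodType k) (W : set V) : option nat :=
  if pselect (exists n, exists b : 'I_n -> V, is_basis W b) is left e
  then Some (projT1 (cid e)) else None.

Definition rank (U V : lmodType k) (f : {linear U -> V}) : option nat :=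
  dim (range f).

End Rank.

Section Intervals.
Context {disp : Order.disp_t} {P : porderType disp}.
Implicit Type A : set P.

Definition convex A := forall s u t, A s -> A t -> (s <= u <= t)%O -> A u.

Definition connected A := forall x y, A x -> A y ->
  exists s : seq P,
    [/\ path (>=<%O) x s, last x s = y & forall z, z \in s -> A z].

Definition is_poset_interval A := [/\ A !=set0, convex A & connected A].

End Intervals.

Record poset_interval disp (P : porderType disp) := PosetInterval {
  interval_set :> set P;
  interval_setP : is_poset_interval interval_set }.

HB.instance Definition _ disp (P : porderType disp) :=
  gen_eqMixin (poset_interval P).
HB.instance Definition _ disp (P : porderType disp) :=
  gen_choiceMixin (poset_interval P).

Section DirectedUnions.
Context {disp : Order.disp_t} {P : porderType disp}.
Implicit Type X : set (poset_interval P).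

Definition directed X := X !=set0 /\
  forall I1 I2, X I1 -> X I2 -> exists2 I3, X I3 & I1 `|` I2 `<=` I3.

(* Hence [hat] below loses nothing by taking values in sets of intervals. *)
Lemma directed_bigcup X :
  directed X -> is_poset_interval (\bigcup_(I in X) (I : set P)).
Proof.
move=> [[I0 XI0] dX]; have [[x0 Ix0] _ _] := interval_setP I0.
split; first by exists x0, I0.
- move=> s u t [I1 X1 I1s] [I2 X2 I2t] sut.
  have [I3 X3 sI3] := dX _ _ X1 X2; have [_ cI3 _] := interval_setP I3.
  by exists I3 => //; apply: cI3 sut; apply: sI3; [left|right].
- move=> x y [I1 X1 I1x] [I2 X2 I2y].
  have [I3 X3 sI3] := dX _ _ X1 X2; have [_ _ cI3] := interval_setP I3.
  have [||s [ps ls sA]] := cI3 x y; [by apply: sI3; left|by apply: sI3; right|].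
  by exists s; split=> // z /sA; exists I3.
Qed.

Definition hat (II : set (poset_interval P)) : set (poset_interval P) :=
  [set J | exists2 X, X `<=` II /\ directed X &
           (J : set P) = \bigcup_(I in X) (I : set P)].

End DirectedUnions.

Record rep (k : fieldType) disp (P : porderType disp) := Rep {
  rep_obj :> P -> lmodType k;
  rep_map : forall p q : P, (p <= q)%O -> {linear rep_obj p -> rep_obj q};
  rep_map_id : forall p (pp : (p <= p)%O) x, rep_map pp x = x;
  rep_map_comp : forall p q r (pq : (p <= q)%O) (qr : (q <= r)%O)
    (pr : (p <= r)%O) x, rep_map pr x = rep_map qr (rep_map pq x) }.

Section DirectSumRep.
Variables (k : fieldType) (disp : Order.disp_t) (P : porderType disp).
Variables (T : eqType) (M : T -> rep k P).

Definition rep_sum_map p q (pq : (p <= q)%O) :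
    {linear dsum (fun i => M i p) -> dsum (fun i => M i q)} :=
  dsum_map (fun i => rep_map (M i) pq).

Fact rep_sum_map_id p (pp : (p <= p)%O) x : rep_sum_map pp x = x.
Proof. by apply: dsum_funP => i; exact: rep_map_id. Qed.

Fact rep_sum_map_comp p q r (pq : (p <= q)%O) (qr : (q <= r)%O)
  (pr : (p <= r)%O) x : rep_sum_map pr x = rep_sum_map qr (rep_sum_map pq x).
Proof. by apply: dsum_funP => i; exact: rep_map_comp. Qed.

Definition rep_sum : rep k P := Rep rep_sum_map_id rep_sum_map_comp.

End DirectSumRep.

Section IntervalRep.
Variables (k : fieldType) (disp : Order.disp_t) (P : porderType disp).
Variable I : poset_interval P.

(* [p \in I] is coerced to a dimension in {0, 1}, so the space at p is k^1 or
   k^0, and [conform_mx 0] is the identity map when the dimensions agree and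
   the zero map otherwise. *)
Definition interval_map p q (x : 'rV[k]_(p \in (I : set P))) :
  'rV[k]_(q \in (I : set P)) := conform_mx 0 x.

Fact interval_map_linear p q : linear (@interval_map p q).
Proof.
rewrite /interval_map => a x y.
case: (p \in _) x y; case: (q \in _) => x y; rewrite ?conform_mx_id//.
  by rewrite !nonconform_mx ?andbF// scaler0 addr0.
by rewrite !nonconform_mx ?andbF// scaler0 addr0.
Qed.

HB.instance Definition _ p q := GRing.isLinear.Build k
  'rV[k]_(p \in (I : set P)) 'rV[k]_(q \in (I : set P)) _
  (@interval_map p q) (@interval_map_linear p q).

Fact interval_map_id p (pp : (p <= p)%O) x : @interval_map p p x = x.
Proof. exact: conform_mx_id. Qed.

Fact interval_map_comp p q r (pq : (p <= q)%O) (qr : (q <= r)%O)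
  (pr : (p <= r)%O) x :
  @interval_map p r x = @interval_map q r (@interval_map p q x).
Proof.
have [_ cI _] := interval_setP I.
have pqr : p \in (I : set P) -> r \in (I : set P) -> q \in (I : set P).
  by rewrite !inE => Ip Ir; apply: cI Ip Ir _; rewrite pq qr.
rewrite /interval_map.
case: (p \in _) pqr x; case: (q \in _); case: (r \in _) => pqr x;
  rewrite ?conform_mx_id//; try by apply/matrixP => ? [].
by have := pqr isT isT.
Qed.

Definition interval_rep : rep k P :=
  @Rep k disp P (fun p => 'rV[k]_(p \in (I : set P)) : lmodType k)
    (fun p q _ => @interval_map p q : {linear _ -> _})
    interval_map_id interval_map_comp.

End IntervalRep.

(* Multi-sets with infinite support are allowed. Finite multiplicities are not a
   restriction here: a multi-set R of elements of [hat II] containing some J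
   infinitely often has Rk_I k_R infinite for every I in II contained in J. *)
Definition multiset (T : Type) := T -> nat.

Section Multisets.
Context {T : Type}.
Implicit Types (A : set T) (R S : multiset T).

Definition multiset_of A R := forall x, (0 < R x)%N -> A x.
Definition msub R S := forall x, (R x <= S x)%N.
Definition mempty : multiset T := fun=> 0%N.
Definition mcap R S : multiset T := fun x => minn (R x) (S x).
Definition mdiff R S : multiset T := fun x => (R x - S x)%N.

End Multisets.

Definition multiset_rep (k : fieldType) disp (P : porderType disp)
    (R : multiset (poset_interval P)) : rep k P :=
  rep_sum (fun i : {J : poset_interval P & 'I_(R J)} => interval_rep k (tag i)).

Section LimColim.
Variables (k : fieldType) (disp : Order.disp_t) (Q : porderType disp).
Variable N : rep k Q.

Definition compatible : {pred dprod N} :=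
  fun x => `[< forall p q (pq : (p <= q)%O), rep_map N pq (x p) = x q >].

Fact compatible_closed : submod_closed compatible.
Proof.
split=> [|a x y /asboolP cx /asboolP cy]; apply/asboolP => p q pq.
  exact: linear0.
by rewrite linearP cx cy.
Qed.

HB.instance Definition _ :=
  GRing.isSubmodClosed.Build k (dprod N) compatible compatible_closed.

Record lim := Lim { lim_fun :> dprod N; _ : lim_fun \in compatible }.

HB.instance Definition _ := [isSub for lim_fun].
HB.instance Definition _ := [Choice of lim by <:].
HB.instance Definition _ := [SubChoice_isSubLmodule of lim by <:].

Definition colim_rel : set (dsum N) :=
  [set z | exists p q (pq : (p <= q)%O) (x : N p),
           z = dsum_in x - dsum_in (rep_map N pq x)].

Definition colim := quot_space colim_rel.

HB.instance Definition _ := GRing.Lmodule.on colim.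

Definition colim_in p (x : N p) : colim := quot_proj _ (dsum_in x).

Lemma colim_in_map p q (pq : (p <= q)%O) (x : N p) :
  colim_in (rep_map N pq x) = colim_in x.
Proof.
by apply/esym/eqP; rewrite quot_projE; apply: sub_span; exists p, q, pq, x.
Qed.

Definition lim_to_colim (p : Q) (x : lim) : colim := colim_in (x p).

Fact lim_to_colim_linear p : linear (lim_to_colim p).
Proof.
move=> a x y; rewrite /lim_to_colim /colim_in.
by rewrite -linearP -linearP.
Qed.

HB.instance Definition _ p :=
  GRing.isLinear.Build k lim colim _ (lim_to_colim p) (lim_to_colim_linear p).

Lemma lim_to_colim_comparable p q (x : lim) :
  (p >=< q)%O -> lim_to_colim p x = lim_to_colim q x.
Proof.
have /asboolP cx := valP x.
by case/orP=> h; rewrite /lim_to_colim -(cx _ _ h) colim_in_map.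
Qed.

End LimColim.

Section GeneralizedRank.
Variables (k : fieldType) (disp : Order.disp_t) (P : porderType disp).

Definition subposet (A : set P) := {p : P | p \in A}.

HB.instance Definition _ A := SubType.on (subposet A).
HB.instance Definition _ A := Choice.on (subposet A).
HB.instance Definition _ A := [SubChoice_isSubPOrder of subposet A by <: with disp].

Definition rep_restrict (M : rep k P) (A : set P) : rep k (subposet A) :=
  @Rep k _ (subposet A) (fun p => M (val p))
    (fun p q pq => rep_map M (pq : (val p <= val q)%O))
    (fun p pp => @rep_map_id k _ P M (val p) pp)
    (fun p q r pq qr pr =>
       @rep_map_comp k _ P M (val p) (val q) (val r) pq qr pr).

Lemma interval_point_subproof (I : poset_interval P) :
  exists p : subposet I, True.
Proof.
by have [[p Ip] _ _] := interval_setP I; exists (exist _ p (mem_set Ip)).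
Qed.

Definition interval_point (I : poset_interval P) : subposet I :=
  projT1 (cid (interval_point_subproof I)).

(* The canonical map from the limit to the colimit: it may be computed at any
   point of the connected poset I, as [canonical_mapE] shows. *)
Definition canonical_map (M : rep k P) (I : poset_interval P) :
    {linear lim (rep_restrict M I) -> colim (rep_restrict M I)} :=
  @lim_to_colim k _ _ (rep_restrict M I) (interval_point I).

Lemma canonical_mapE M I p x : canonical_map M I x = lim_to_colim p x.
Proof.
rewrite /canonical_map /=; move: (interval_point I) => q.
have [_ _ /(_ (val q) (val p) (set_mem (valP q)) (set_mem (valP p)))] :=
  interval_setP I.
move=> [s [ps ls sI]].
elim: s q ps ls sI => [|r s IHs] q /=.
  by move=> _ /val_inj ->.
move=> /andP[qr ps] ls sI.
have Ir : r \in (I : set P) by apply/mem_set/sI; rewrite mem_head.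
rewrite (@lim_to_colim_comparable _ _ _ _ q (exist _ r Ir : subposet I))//.
by apply: IHs => //= z zs; apply: sI; rewrite inE zs orbT.
Qed.

Definition Rk (M : rep k P) (I : poset_interval P) : option nat :=
  rank (canonical_map M I).

Definition rep_finite (II : set (poset_interval P)) (M : rep k P) :=
  forall I, II I -> Rk M I <> None.

(* Only meaningful when [Rk M I <> None]; integer-valued, so that differences
   are not truncated. *)
Definition Rkz (M : rep k P) (I : poset_interval P) : int :=
  (odflt 0%N (Rk M I))%:Z.

End GeneralizedRank.

(* Main.v *)
(* The canonical map lim -> colim of a direct sum of interval representations
   k_(J i) over an interval I kills every component with I not inside J i: such
   a component is itself a compatible section that vanishes at a point of I, and
   the map may be computed at any point of the connected poset I. The components
   with I inside J i each contribute one dimension, so Rk_I k_R is the number,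
   with multiplicity, of the members of R that contain I.
   Put U = R + S* and V = S + R*; these have the same finite number of members
   containing I, for every I in II. If U and V had different multiplicities
   somewhere, pick J maximal for inclusion among the intervals where they
   differ: J is a directed union of members of II, and finiteness yields a
   member I' of that union which no other such interval contains. Counting over
   I' gives U J = V J, a contradiction. So U = V, and disjointness of R* and S*
   gives the claim. *)
From HB Require Import structures.
Require Import Defs.
From mathcomp Require Import all_boot all_order all_algebra.
From mathcomp Require Import boolp classical_sets cardinality fsbigop.
From mathcomp Require Import zify.

Local Open Scope ring_scope.

Set Implicit Arguments.
Unset Strict Implicit.
Unset Printing Implicit Defensive.

Import Order.TTheory GRing.Theory.

Local Open Scope classical_set_scope.

(** * Linear algebra: sizes of free and generating families *)

(** A row vector killing the coefficient matrix [A] gives a vanishing combination of the [v i], so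
    [A] has full row rank. *)
Lemma free_family_leq (k : fieldType) (V : lmodType k) m n
    (v : 'I_m -> V) (b : 'I_n -> V) :
    (forall c : 'I_m -> k, \sum_i c i *: v i = 0 -> forall i, c i = 0) ->
    (forall i, exists c : 'I_n -> k, v i = \sum_j c j *: b j) ->
  (m <= n)%N.
Proof.
move=> vfree /choice[C vE].
pose A : 'M[k]_(m, n) := \matrix_(i, j) C i j.
suff /eqP <- : row_free A by exact: rank_leq_col.
rewrite -kermx_eq0; apply/rowV0P => u /sub_kermxP uA0.
apply/rowP => i; rewrite mxE; apply: (vfree (fun i => u ord0 i)).
under eq_bigr do rewrite vE scaler_sumr.
rewrite exchange_big big1// => j _.
under eq_bigr do rewrite scalerA.
rewrite -scaler_suml (_ : \sum_i _ = (u *m A) ord0 j).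
  by rewrite uA0 mxE scale0r.
by rewrite mxE; apply: eq_bigr => i' _; rewrite mxE.
Qed.

(** * Direct sums and functionals on them *)

Section DirectSum.
Variables (k : fieldType) (T : eqType) (V : T -> lmodType k).

Lemma dsum_support_seq (z : dsum V) :
  exists2 s : seq T, uniq s & forall i, z i != 0 -> i \in s.
Proof.
have /asboolP/finite_seqP[s sE] : dsum_fun z \in @fin_supp k T V.
  by case: z.
exists (undup s); rewrite ?undup_uniq// => i zi.
have : [set i | z i != 0] i by [].
by rewrite sE /= mem_undup.
Qed.

Lemma dsum_sumE (I : Type) (r : seq I) (F : I -> dsum V) i :
  (\sum_(a <- r) F a : dsum V) i = \sum_(a <- r) (F a i).
Proof.
elim: r => [|a r IHr]; first by rewrite !big_nil.
by rewrite !big_cons -IHr.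
Qed.

Lemma dsum_decomp (z : dsum V) (s : seq T) :
    uniq s -> (forall i, z i != 0 -> i \in s) ->
  z = \sum_(i <- s) dsum_in (z i).
Proof.
move=> us zs; apply: dsum_funP => i; rewrite dsum_sumE.
have [si|nsi] := boolP (i \in s).
  rewrite (bigD1_seq i)// dsum_inE big1 => [|j ji]; first exact/esym/addr0.
  by rewrite dsum_in_out.
rewrite big_seq big1 => [|j js].
  by apply/eqP; exact: contraNT (zs i) nsi.
by rewrite dsum_in_out//; apply: contraNneq nsi => <-.
Qed.

End DirectSum.

Section DirectSumTotal.
Variables (k : fieldType) (T : choiceType) (V : T -> lmodType k).
Variable f : forall i, {linear V i -> k^o}.

(** The functional induced by the [f i] through the universal property of the direct sum. As [z] has
    finite support, the default value 0 of sums with infinite support never intervenes. *)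
Definition dsum_total (z : dsum V) : k := \sum_(i \in [set: T]) f i (z i).

Lemma dsum_totalE (z : dsum V) (s : seq T) :
    uniq s -> (forall i, z i != 0 -> i \in s) ->
  dsum_total z = \sum_(i <- s) f i (z i).
Proof.
move=> us zs; rewrite /dsum_total (fsbigE s)//.
  by apply: eq_bigl => i; rewrite in_setT.
move=> i _; apply: contraNeq => fzi; apply: zs.
by apply: contraNneq fzi => ->; rewrite linear0.
Qed.

Lemma dsum_total_linear : linear (dsum_total : dsum V -> k^o).
Proof.
move=> a x y.
have [sx _ xs] := dsum_support_seq x; have [sy _ ys] := dsum_support_seq y.
(* One list carrying both supports reduces linearity to finite sums. *)
pose s := undup (sx ++ sy); have us : uniq s by exact: undup_uniq.
have sE i : i \notin s -> x i = 0 /\ y i = 0.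
  rewrite mem_undup mem_cat negb_or => /andP[isx isy].
  by split; apply/eqP; [exact: contraNT (xs i) isx|exact: contraNT (ys i) isy].
rewrite (dsum_totalE us (z := x)); last first.
  by move=> i; apply: contra_neqT => /sE[].
rewrite (dsum_totalE us (z := y)); last first.
  by move=> i; apply: contra_neqT => /sE[].
rewrite (dsum_totalE us (z := a *: x + y)); last first.
  move=> i; apply: contra_neqT => /sE[xi yi].
  change (a *: x i + y i = 0).
  by rewrite xi yi scaler0 addr0.
rewrite scaler_sumr -big_split; apply: eq_bigr => i _.
exact: linearP.
Qed.

Lemma dsum_total_in i (x : V i) : dsum_total (dsum_in x) = f i x.
Proof.
rewrite (@dsum_totalE _ [:: i])//; first by rewrite big_seq1 dsum_inE.
move=> j; rewrite inE; apply: contra_neqT => ji.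
by rewrite dsum_in_out// eq_sym.
Qed.

HB.instance Definition _ :=
  GRing.isLinear.Build k (dsum V) k^o _ dsum_total dsum_total_linear.

End DirectSumTotal.

(** * Functionals on spans and colimits *)

(** The kernel of [f] is one of the submodules over which [span] quantifies. *)
Lemma span_kernel (k : fieldType) (V : lmodType k) (A : set V)
    (f : {linear V -> k^o}) (x : V) :
  (forall y, A y -> f y = 0) -> x \in Defs.span A -> f x = 0.
Proof.
move=> fA.
pose kerf : {pred V} := fun x => f x == 0.
have kerf_closed : submod_closed kerf.
  split=> [|a u v]; rewrite !unfold_in; first by rewrite linear0.
  by rewrite linearP => /eqP-> /eqP->; rewrite scaler0 addr0.
pose m := GRing.isSubmodClosed.Build k V kerf kerf_closed.
pose W : submodClosed V := HB.pack kerf m.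
by move=> /asboolP/(_ W) xW; apply/eqP/xW => y /fA/eqP.
Qed.

Lemma colim_in_linear (k : fieldType) disp (Q : porderType disp) (N : rep k Q)
  (p : Q) : linear (@colim_in k disp Q N p).
Proof. by move=> a x y; rewrite /colim_in !linearP. Qed.

HB.instance Definition _ (k : fieldType) disp (Q : porderType disp)
    (N : rep k Q) (p : Q) :=
  GRing.isLinear.Build k (N p) (colim N) _ (@colim_in k disp Q N p)
    (@colim_in_linear k disp Q N p).

(** The hypothesis makes [f] a cocone, so its total kills the relations defining the colimit. This
    serves to detect non-zero classes there. *)
Lemma colim_in_eq0 (k : fieldType) disp (Q : porderType disp) (N : rep k Q)
    (f : forall p, {linear N p -> k^o}) (p : Q) (x : N p) :
    (forall p q (pq : (p <= q)%O) (x : N p), f q (rep_map N pq x) = f p x) ->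
  colim_in x = 0 -> f p x = 0.
Proof.
move=> fN x0; rewrite -dsum_total_in.
apply: (@span_kernel _ _ (@colim_rel k disp Q N)).
  by move=> _ [q [r [qr [y ->]]]]; rewrite linearB /= !dsum_total_in fN subrr.
move/eqP: x0; rewrite -(linear0 (quot_proj (colim_rel (N:=N)))) quot_projE.
by rewrite subr0.
Qed.

Lemma dsum_map_in (k : fieldType) (T : eqType) (V W : T -> lmodType k)
    (f : forall i, {linear V i -> W i}) i (x : V i) :
  dsum_map f (dsum_in x) = dsum_in (f i x).
Proof.
apply: dsum_funP => j; rewrite -[LHS]/(f j (dsum_in x j)).
have [<-|ij] := eqVneq i j; first by rewrite !dsum_inE.
by rewrite !dsum_in_out//; exact: linear0.
Qed.

Lemma big_seq_widen (V : nmodType) (T : eqType) (s s' : seq T) (F : T -> V) :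
    uniq s -> uniq s' -> {subset s <= s'} ->
  \sum_(i <- s) F i = \sum_(i <- s') (if i \in s then F i else 0).
Proof.
move=> us us' ss'; rewrite -big_mkcond -[RHS]big_filter.
apply: perm_big; apply: uniq_perm => //; first exact: filter_uniq.
by move=> i; rewrite mem_filter andbC; case: (boolP (i \in s)) => [/ss' ->|_];
  rewrite ?andbF.
Qed.

Lemma dim_basis (k : fieldType) (V : lmodType k) (W : set V) n :
  Defs.dim W = Some n -> exists b : 'I_n -> V, is_basis W b.
Proof.
rewrite /Defs.dim; case: pselect => // e [<-].
exact: (svalP (cid e)).
Qed.

(** * Coordinates on the spaces of an interval representation *)

Section RowSum.
Variables (k : fieldType) (n : nat).

(** For [n] in {0, 1} this is the only coordinate, or 0; summing avoids naming an index that exists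
    only inside the interval. *)
Definition row_sum (x : 'rV[k]_n) : k := \sum_j x ord0 j.

Lemma row_sum_linear : linear (row_sum : _ -> k^o).
Proof.
move=> a x y; rewrite /row_sum; under eq_bigr do rewrite !mxE.
by rewrite big_split -mulr_sumr.
Qed.

HB.instance Definition _ :=
  GRing.isLinear.Build k 'rV[k]_n k^o _ row_sum row_sum_linear.

End RowSum.

Lemma row_sum_const (k : fieldType) (b : bool) (x : 'rV[k]_b) :
  b -> x = row_sum x *: const_mx 1.
Proof.
case: b x => // x _; apply/rowP => j.
by rewrite !mxE /row_sum big_ord1 mulr1 ord1.
Qed.

Lemma row_sum_interval_map (k : fieldType) disp (P : porderType disp)
    (I : poset_interval P) p q (x : 'rV[k]_(p \in (I : set P))) :
    p \in (I : set P) -> q \in (I : set P) ->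
  row_sum (interval_map q x) = row_sum x.
Proof.
rewrite /interval_map => Ip Iq.
by case: (p \in _) Ip x; case: (q \in _) Iq => // _ _ x; rewrite conform_mx_id.
Qed.

(** * The rank of a direct sum of interval representations *)

Section IntervalSumRank.
Variables (k : fieldType) (disp : Order.disp_t) (P : porderType disp).
Variables (T : eqType) (J : T -> poset_interval P) (I : poset_interval P).

Let M := rep_sum (fun i => interval_rep k (J i)).
Let N := rep_restrict M I.

Definition sum_unit i (p : subposet I) : N p :=
  dsum_in (V := fun i => interval_rep k (J i) (val p)) (i := i)
    (const_mx 1 : 'rV_(val p \in (J i : set P))).

Definition sum_unit_colim i : colim N :=
  colim_in (sum_unit i (interval_point I)).

Lemma subposet_mem i (p : subposet I) :
  (I : set P) `<=` J i -> val p \in (J i : set P).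
Proof. by move=> IJ; apply/mem_set/IJ/set_mem/(valP p). Qed.

(** When [I] lies inside [J i], the units of the summand [i] form a compatible section, a preimage
    of the class. *)
Lemma sum_unit_colim_range i : (I : set P) `<=` J i ->
  range (canonical_map M I) (sum_unit_colim i).
Proof.
move=> IJ.
have ec : (sum_unit i : dprod N) \in compatible (N := N).
  apply/asboolP => p q pq.
  rewrite /sum_unit.
  rewrite [LHS](@dsum_map_in k T _ _
    (fun i => rep_map (interval_rep k (J i)) _)).
  congr dsum_in.
  have := subposet_mem p IJ; have := subposet_mem q IJ.
  rewrite /= /interval_map; case: (_ \in _) => //; case: (_ \in _) => // _ _.
  by rewrite conform_mx_id.
by exists (Lim ec).
Qed.

Definition sum_coef i (p : subposet I) (z : N p) : k :=
  row_sum ((z : dsum _) i : 'rV_(_ \in (J i : set P))).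

Lemma sum_coef_linear i p : linear (@sum_coef i p : N p -> k^o).
Proof. by move=> a x y; exact: row_sum_linear. Qed.

HB.instance Definition _ i p :=
  GRing.isLinear.Build k (N p) k^o _ (@sum_coef i p : N p -> k^o)
    (@sum_coef_linear i p).

(** Over [I] inside [J i] the summand [i] is constant, so its coefficient is a cocone. *)
Lemma sum_coef_map i p q (pq : (p <= q)%O) (z : N p) :
  (I : set P) `<=` J i -> sum_coef i (rep_map N pq z) = sum_coef i z.
Proof.
move=> IJ.
exact (row_sum_interval_map _ (subposet_mem p IJ) (subposet_mem q IJ)).
Qed.

Lemma sum_coef_unit i j (p : subposet I) :
  (I : set P) `<=` J i -> sum_coef i (sum_unit j p) = (i == j)%:R.
Proof.
move=> /(subposet_mem p) Jp; rewrite /sum_coef /sum_unit.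
have [<-|ij] := eqVneq i j; last first.
  by rewrite dsum_in_out 1?eq_sym// /row_sum big1// => a _; rewrite mxE.
rewrite dsum_inE.
by move: Jp; case: (_ \in _) => // _; rewrite /row_sum big_ord1 mxE.
Qed.

Lemma canonical_map_sum (s : seq T) (x : lim N) :
    uniq s -> (forall i, i \in s <-> (I : set P) `<=` J i) ->
  canonical_map M I x = \sum_(i <- s)
    sum_coef i (x (interval_point I)) *: sum_unit_colim i.
Proof.
move=> us sE.
set p := interval_point I.
have [s0 us0 s0E] := dsum_support_seq (x p).
(* Both sides become sums over [s1], which contains the support of [x p] as well as [s]. *)
pose s1 := undup (s0 ++ s).
rewrite -[LHS]/(colim_in (x p)).
rewrite [in LHS](@dsum_decomp _ _ _ (x p) s1); first last.
- by move=> i /s0E; rewrite mem_undup mem_cat => ->.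
- exact: undup_uniq.
rewrite linear_sum.
rewrite [RHS](@big_seq_widen _ _ s s1)//; last 2 first.
- exact: undup_uniq.
- by move=> i si; rewrite mem_undup mem_cat si orbT.
apply: eq_bigr => i _.
case: ifPn => [/sE IJ|nsi].
  rewrite -linearZ; congr colim_in; rewrite /sum_unit -linearZ; congr dsum_in.
  exact (row_sum_const _ (subposet_mem p IJ)).
(* For [i] outside [s], the component [i] of [x] is itself a compatible section. *)
have yc : ((fun q => dsum_in ((x q : dsum _) i)) : dprod N)
    \in compatible (N := N).
  apply/asboolP => q r qr.
  rewrite [LHS](@dsum_map_in k T _ _
    (fun i => rep_map (interval_rep k (J i)) _)).
  have /asboolP cx := valP x.
  by rewrite -(cx _ _ qr).
have [q [Iq nJq]] : (I : set P) `&` ~` (J i : set P) !=set0.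
  by apply: nonsubset => IJ; move/negP: nsi; apply; apply/sE.
(* The summand [i] is zero at [q'], and the canonical map may be computed there instead of at
   [p]. *)
pose q' : subposet I := exist _ q (mem_set Iq).
rewrite -[LHS]/(lim_to_colim p (Lim yc)).
rewrite -canonical_mapE (canonical_mapE q') /lim_to_colim.
rewrite -[RHS](linear0 (colim_in (p := q'))); congr colim_in => /=.
rewrite -[RHS](linear0 (dsum_in (i := i))); congr dsum_in.
move: ((x q' : dsum _) i) => y /=; move: y.
have := memNset nJq; rewrite /q' /=; case: (_ \in _) => // _ y.
by apply/rowP => -[].
Qed.

(** The coefficient of the summand [f a] passes to the colimit and reads off [c a]. *)
Lemma sum_unit_colim_free m (f : 'I_m -> T) (c : 'I_m -> k) :
    injective f -> (forall a, (I : set P) `<=` J (f a)) ->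
  \sum_a c a *: sum_unit_colim (f a) = 0 -> forall a, c a = 0.
Proof.
move=> finj fJ c0 a; set p := interval_point I.
have : colim_in (\sum_a c a *: sum_unit (f a) p) = 0 :> colim N.
  rewrite -[RHS]c0 linear_sum; apply: eq_bigr => b _; exact: linearZ.
move/(colim_in_eq0 (f := fun p => sum_coef (f a) (p := p))) => /(_ _)/wrap[].
  by move=> q r qr x; exact: sum_coef_map.
move=> ca0.
have : \sum_b c b * sum_coef (f a) (sum_unit (f b) p) = 0.
  rewrite -[RHS]ca0 linear_sum; apply: eq_bigr => b _.
  exact/esym/linearZ.
rewrite (bigD1 a)//= sum_coef_unit// eqxx mulr1.
rewrite big1 ?addr0// => b ba; rewrite sum_coef_unit//.
by rewrite (inj_eq finj) eq_sym (negPf ba) mulr0.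
Qed.

(** The unit classes of the summands with [I] inside [J i] are free and generate the image. *)
Lemma Rk_rep_sum n : Rk M I = Some n ->
  exists s : seq T, [/\ uniq s, forall i, i \in s <-> (I : set P) `<=` J i
                     & size s = n].
Proof.
move=> /dim_basis[b [bfree bE]].
have s_size (s : seq T) :
    uniq s -> (forall i, i \in s -> (I : set P) `<=` J i) -> (size s <= n)%N.
  move=> /(tuple_uniqP (in_tuple s)) us sJ.
  apply: (@free_family_leq k _ _ _
    (fun a => sum_unit_colim (tnth (in_tuple s) a)) b).
    move=> c; apply: sum_unit_colim_free => // a.
    by apply: sJ; exact: mem_tnth.
  move=> a; have := @sum_unit_colim_range (tnth (in_tuple s) a).
  rewrite bE => -[|c _ <-]; last by exists c.
  by apply: sJ; exact: mem_tnth.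
(* [T] may be infinite. Freeness bounds by [n] the length of a list of such indices, and one of
   maximal length must contain them all. *)
pose Q l := `[< exists s : seq T,
  [/\ uniq s, forall i, i \in s -> (I : set P) `<=` J i & size s = l] >].
have Q0 : exists l, Q l by exists 0%N; apply/asboolP; exists [::].
have Qm l : Q l -> (l <= n)%N by move=> /asboolP[s [us sJ <-]]; exact: s_size.
have [l /asboolP[s [us sJ sl]] lmax] := ex_maxnP Q0 Qm.
have sE i : i \in s <-> (I : set P) `<=` J i.
  split=> [/sJ//|IJ]; apply: contraT => nsi.
  have /lmax : Q (size s).+1.
    apply/asboolP; exists (i :: s); split=> //=; first by rewrite nsi.
    by move=> j; rewrite inE => /predU1P[->|/sJ].
  by rewrite -sl ltnn.
exists s; split=> //; apply/eqP; rewrite eqn_leq s_size//=.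
(* Conversely each [b j] lies in the image, hence is a combination of the unit classes. *)
apply: (@free_family_leq k _ _ _ b
  (fun a => sum_unit_colim (tnth (in_tuple s) a))) => // j.
have : range (canonical_map M I) (b j).
  rewrite bE; exists (fun i => (i == j)%:R) => //.
  rewrite (bigD1 j)//= eqxx scale1r big1 ?addr0// => i /negPf->.
  by rewrite scale0r.
move=> [x _ <-]; rewrite (canonical_map_sum x us sE) big_tnth.
by eexists.
Qed.

End IntervalSumRank.

(** * Ranks of multi-sets as counts with multiplicity *)

Lemma Rk_multiset_rep (k : fieldType) disp (P : porderType disp)
    (R : multiset (poset_interval P)) (I : poset_interval P) n :
  Rk (multiset_rep k R) I = Some n ->
  exists s : seq (poset_interval P),
    [/\ uniq s, forall J, J \in s <-> (0 < R J)%N /\ (I : set P) `<=` J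
      & n = (\sum_(J <- s) R J)%N].
Proof.
move=> /Rk_rep_sum[s [us sE <-]].
have sP J : J \in undup (map tag s) <-> (0 < R J)%N /\ (I : set P) `<=` J.
  rewrite mem_undup; split=> [/mapP[[J' a] /sE IJ ->]|[RJ IJ]].
    by split=> //; exact: leq_ltn_trans (leq0n a) (ltn_ord a).
  by apply/mapP; exists (existT _ J (Ordinal RJ)) => //; apply/sE.
exists (undup (map tag s)); split=> //; first exact: undup_uniq.
(* Membership in [s] depends only on the tag, so [s] contains all [R J] copies of each [J] that
   occurs. *)
transitivity (size [seq existT (fun J => 'I_(R J)) J a
  | J <- undup (map tag s), a <- enum 'I_(R J)]).
  apply: perm_size; apply: uniq_perm => //.
    apply: allpairs_uniq_dep => [|J _|]; rewrite ?undup_uniq ?enum_uniq//.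
    by move=> x y _ _; case: x => ? ?; case: y.
  move=> [J a]; apply/idP/allpairsPdep => [Ja|[J' [a' [/sP[_ IJ] _ ->]]]].
    exists J, a; rewrite mem_enum mem_undup; split=> //.
    by apply/mapP; exists (existT _ J a).
  exact/sE.
rewrite size_allpairs_dep sumnE big_map; apply: eq_bigr => J _.
by rewrite size_enum_ord.
Qed.

(** Intervals of [t] outside [s] have multiplicity 0. The freedom in [t] lets several multi-sets be
    summed over one list. *)
Lemma Rk_multiset_rep_sum (k : fieldType) disp (P : porderType disp)
    (R : multiset (poset_interval P)) (I : poset_interval P) :
    Rk (multiset_rep k R) I <> None ->
  exists s : seq (poset_interval P),
    (forall J, J \in s <-> (0 < R J)%N /\ (I : set P) `<=` J) /\
    forall t : seq (poset_interval P), uniq t -> {subset s <= t} ->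
      (forall J, J \in t -> (I : set P) `<=` J) ->
    Rkz (multiset_rep k R) I = (\sum_(J <- t) R J)%N%:Z.
Proof.
rewrite /Rkz; case E: (Rk _ I) => [n|//] _.
have [s [us sE nE]] := Rk_multiset_rep E.
exists s; split=> // t ut st tI.
rewrite /= nE; congr Posz.
rewrite [LHS](@big_seq_widen nat _ s t)//; apply: eq_big_seq => J Jt.
case: ifPn => // nJ; apply/esym/eqP; rewrite eqn0Ngt.
by apply: contra nJ => RJ; apply/sE; split=> //; exact: tI.
Qed.

(** * Recovering a multi-set of directed unions from its counts *)

Lemma interval_set_inj disp (P : porderType disp) :
  injective (@interval_set disp P).
Proof.
move=> [A hA] [B hB] /= AB; case: _ / AB in hB *.
by congr PosetInterval; exact: Prop_irrelevance.
Qed.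

(** By induction, the new head replaces the chosen element exactly when it dominates it. Without
    antisymmetry, maximality holds up to mutual [r]. *)
Lemma seq_maximal (T : eqType) (r : T -> T -> Prop) (s : seq T) :
    (forall y x z, r x y -> r y z -> r x z) -> s != [::] ->
  exists2 x, x \in s & forall y, y \in s -> r x y -> r y x.
Proof.
move=> rT; elim: s => // a s IHs _.
have [-> |/IHs[x xs xmax]] := eqVneq s [::].
  by exists a; rewrite ?mem_head// => y; rewrite inE => /eqP->.
have [xa|nxa] := pselect (r x a).
  exists a; rewrite ?mem_head// => y; rewrite inE => /predU1P[->//|ys] ay.
  exact: (rT _ _ _ (xmax _ ys (rT _ _ _ xa ay)) xa).
exists x; first by rewrite inE xs orbT.
by move=> y; rewrite inE => /predU1P[->//|]; exact: xmax.
Qed.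

(** For each [J] in [l], pick a point of the union outside [J]; directedness provides a member that
    contains [I] and all these points. *)
Lemma directed_escape disp (P : porderType disp) (X : set (poset_interval P))
    (I : poset_interval P) (l : seq (poset_interval P)) :
    directed X -> X I ->
    (forall J, J \in l -> ~ \bigcup_(A in X) (A : set P) `<=` J) ->
  exists I', [/\ X I', (I : set P) `<=` I'
              & forall J, J \in l -> ~ (I' : set P) `<=` J].
Proof.
move=> [_ dX] XI; elim: l => [|J l IHl] lX; first by exists I; split.
have [J' J'l|I1 [XI1 I1I I1l]] := IHl.
  by apply: (lX J'); rewrite inE J'l orbT.
have /nonsubset[q [[I2 XI2 I2q] nJq]] := lX J (mem_head _ _).
have [I3 XI3 sI3] := dX _ _ XI1 XI2; exists I3; split=> //.
  by move=> x /I1I I1x; apply: sI3; left.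
move=> J'; rewrite inE => /predU1P[->|/I1l nJ'] sI3J.
  by apply/nJq/sI3J/sI3; right.
by apply: nJ' => x I1x; apply/sI3J/sI3; left.
Qed.

Lemma hat_multiset_inj disp (P : porderType disp) (II : set (poset_interval P))
    (U V : multiset (poset_interval P)) :
    multiset_of (hat II) U -> multiset_of (hat II) V ->
    (forall I : poset_interval P, II I ->
      exists t : seq (poset_interval P),
        [/\ uniq t, forall J, J \in t -> (I : set P) `<=` J,
            forall J, U J <> V J -> (I : set P) `<=` J -> J \in t
          & (\sum_(J <- t) U J = \sum_(J <- t) V J)%N]) ->
  U = V.
Proof.
move=> hU hV UV; apply/funext => J0; apply: contrapT => UVJ0.
have hatP J : U J <> V J -> hat II J.
  case: (posnP (U J)) => [U0 | /hU//]; case: (posnP (V J)) => [V0|/hV//].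
  by rewrite U0 V0.
have bigcup_sub (X : set (poset_interval P)) (J I : poset_interval P) :
    (J : set P) = \bigcup_(A in X) (A : set P) -> X I -> (I : set P) `<=` J.
  by move=> -> XI x Ix; exists I.
have [J UVJ Jmax] : exists2 J, U J <> V J & forall J', U J' <> V J' ->
    (J : set P) `<=` J' -> (J' : set P) `<=` J.
  have [X [XII [[I0 XI0] _]] J0E] := hatP _ UVJ0.
  have I0J0 := bigcup_sub _ _ _ J0E XI0.
  have [t [_ _ tUV _]] := UV _ (XII _ XI0).
  (* Finitely many differing intervals contain [I0]. Anything above one of them contains [I0] too,
     so a maximal element of [d] is maximal among all differing intervals. *)
  pose d := [seq J <- t | (U J != V J) && `[< (I0 : set P) `<=` J >]].
  have dP J : J \in d <-> U J <> V J /\ (I0 : set P) `<=` J.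
    rewrite mem_filter; split=> [/andP[/andP[/eqP ? /asboolP]]//|[? I0J]].
    by rewrite tUV// andbT; apply/andP; split; [exact/eqP|exact/asboolP].
  have [||J /dP[UVJ I0J] Jmax] :=
    @seq_maximal _ (fun A B : poset_interval P => (A : set P) `<=` B) d.
  - by move=> B A C; exact: subset_trans.
  - by apply/eqP => d0; have /dP : U J0 <> V J0 /\ (I0 : set P) `<=` J0 by [];
      rewrite d0.
  exists J => // J' UVJ' JJ'; apply: Jmax => //; apply/dP; split=> //.
  exact: subset_trans JJ'.
have [X [XII dX] JE] := hatP _ UVJ; have [[I XI] _] := dX.
have [t [_ _ tUV _]] := UV _ (XII _ XI).
(* By maximality of [J], no other differing interval contains the union [J], so some [I'] escapes
   those in [t]. *)
have [J'|I' [XI' II' nI']] := directed_escape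
    (l := [seq J' <- t | (U J' != V J') && (J' != J)]) dX XI.
  rewrite mem_filter => /andP[/andP[/eqP UVJ' /eqP J'J] _]; rewrite -JE => JJ'.
  by apply: J'J; apply: interval_set_inj; apply/seteqP; split=> //; exact: Jmax.
have [t' [ut' t'I' t'UV sumUV]] := UV _ (XII _ XI').
have Jt' : J \in t' by apply: t'UV => //; exact: bigcup_sub JE _.
move: sumUV; rewrite !(bigD1_seq J Jt' ut') /=.
rewrite [X in (_ + X = _)%N -> _](_ : _ = (\sum_(i <- t' | i != J) V i)%N).
  by move=> /addIn.
(* Any other differing interval containing [I'] would contain [I], hence be on the escaped list; so
   all terms but that of [J] agree. *)
rewrite big_seq_cond [RHS]big_seq_cond; apply: eq_bigr => J' /andP[J't' J'J].
apply: contrapT => UVJ'; apply: (nI' J'); last exact: t'I'.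
rewrite mem_filter J'J andbT; apply/andP; split; first exact/eqP.
by apply: tUV => //; apply: (subset_trans II'); exact: t'I'.
Qed.

Theorem theorem2p6 (k : fieldType) (disp : Order.disp_t) (P : porderType disp)
    (II : set (poset_interval P))
    (R S Rs Ss : multiset (poset_interval P))
    (hR : multiset_of (hat II) R) (hS : multiset_of (hat II) S)
    (hRs : multiset_of (hat II) Rs) (hSs : multiset_of (hat II) Ss)
    (fR : rep_finite II (multiset_rep k R))
    (fS : rep_finite II (multiset_rep k S))
    (fRs : rep_finite II (multiset_rep k Rs))
    (fSs : rep_finite II (multiset_rep k Ss))
    (disj : mcap Rs Ss = mempty)
    (eqRk : forall I : poset_interval P, II I ->
      Rkz (multiset_rep k R) I - Rkz (multiset_rep k S) I =
      Rkz (multiset_rep k Rs) I - Rkz (multiset_rep k Ss) I) :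
  [/\ msub Rs R, msub Ss S & mdiff R Rs = mdiff S Ss].
Proof.
(* Moving the negative terms across gives sums of multi-sets, free of truncated subtraction. *)
have addE : (fun J => R J + Ss J)%N = (fun J => S J + Rs J)%N.
  apply: (@hat_multiset_inj _ P II).
  - move=> J; case: (posnP (R J)) => [->|/hR//]; exact: hSs.
  - move=> J; case: (posnP (S J)) => [->|/hS//]; exact: hRs.
  move=> I II_I; have := eqRk _ II_I.
  have [sR [sRP RE]] := Rk_multiset_rep_sum (fR _ II_I).
  have [sS [sSP SE]] := Rk_multiset_rep_sum (fS _ II_I).
  have [sRs [sRsP RsE]] := Rk_multiset_rep_sum (fRs _ II_I).
  have [sSs [sSsP SsE]] := Rk_multiset_rep_sum (fSs _ II_I).
  (* [t] collects the intervals containing [I] from all four multi-sets; the others containing [I]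
     have multiplicity 0 in each. *)
  pose t := undup (sR ++ sS ++ sRs ++ sSs).
  have tE J : (J \in t) = [|| J \in sR, J \in sS, J \in sRs | J \in sSs].
    by rewrite mem_undup !mem_cat.
  have ut : uniq t by exact: undup_uniq.
  have tI J : J \in t -> (I : set P) `<=` J.
    by rewrite tE => /or4P[/sRP|/sSP|/sRsP|/sSsP] [].
  rewrite (RE t)// => [|J JR]; last by rewrite tE JR.
  rewrite (SE t)// => [|J JS]; last by rewrite tE JS orbT.
  rewrite (RsE t)// => [|J JRs]; last by rewrite tE JRs !orbT.
  rewrite (SsE t)// => [|J JSs]; last by rewrite tE JSs !orbT.
  move=> tRk; exists t; split=> // [J neq IJ|]; last first.
    by rewrite !big_split /=; lia.
  rewrite tE; apply/or4P.
  case: (posnP (R J)) => [R0|]; last by move=> RJ; apply: Or41; apply/sRP.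
  case: (posnP (S J)) => [S0|]; last by move=> SJ; apply: Or42; apply/sSP.
  case: (posnP (Rs J)) => [Rs0|]; last by move=> RsJ; apply: Or43; apply/sRsP.
  case: (posnP (Ss J)) => [Ss0|]; last by move=> SsJ; apply: Or44; apply/sSsP.
  by case: neq; rewrite R0 S0 Rs0 Ss0.
(* Pointwise, [Rs J] or [Ss J] is 0, and each claim becomes linear arithmetic. *)
have addP J := congr1 (fun f : _ -> nat => f J) addE.
have disjP J := congr1 (fun f : _ -> nat => f J) disj.
rewrite /= /mcap /mempty in addP disjP.
split=> [J|J|]; last apply/funext => J; rewrite /mdiff.
all: have := addP J; have := disjP J; lia.
Qed.
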